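(* Let $n\ge2$. There exists a continuous map $\varphi:\mathcal K_0^n\times[0,1]\to\mathcal K_0^n$ such that $\varphi(A,0)=A$ and $\varphi(A,1)=\mathbb B$ for all $A\in\mathcal K_0^n$, and $\varphi(A^\circ,t)=\varphi(A,t)^\circ$ for all $A\in\mathcal K_0^n$ and $t\in[0,1]$. That is, $\mathcal K_0^n$ with the $\mathbb Z_2$-action given by the polar mapping $A\mapsto A^\circ$ is $\mathbb Z_2$-contractible to its fixed point $\mathbb B$.
   Context: $\mathbb B$ is the closed Euclidean unit ball of $\mathbb R^n$. $\mathcal K_0^n$ is the family of closed convex subsets of $\mathbb R^n$ containing $0$, with the Attouch–Wets metric $d_{AW}(A,K)=\sup_{j\in\mathbb N}\min\{\frac1j,\sup_{\|x\|<j}|d(x,A)-d(x,K)|\}$, $d(x,A)=\inf_{a\in A}\|x-a\|$. The polar of $A$ is $A^\circ=\{x:\sup_{a\in A}\langle a,x\rangle\le1\}$; the polar mapping $A\mapsto A^\circ$ is an involution of $\mathcal K_0^n$ whose unique fixed point is $\mathbb B$. *)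

(* Defs.v *)
From HB Require Import structures.
From mathcomp Require Import all_boot all_order all_algebra.
From mathcomp Require Import all_classical all_reals all_analysis.
Set Implicit Arguments. Unset Strict Implicit. Unset Printing Implicit Defensive.
Import Order.TTheory GRing.Theory Num.Theory.
Import numFieldNormedType.Exports.
Local Open Scope classical_set_scope.
Local Open Scope ring_scope.

Section Defs.
Variables (R : realType) (n : nat).
Notation vec := 'rV[R]_n.

Definition dotv (x y : vec) : R := \sum_(i < n) x ord0 i * y ord0 i.
Definition enorm (x : vec) : R := Num.sqrt (dotv x x).

Definition unit_ball : set vec := [set x | enorm x <= 1].

Definition convex_set_of (A : set vec) : Prop :=
  forall a b, A a -> A b -> forall l : R, 0 <= l -> l <= 1 ->
    A (l *: a + (1 - l) *: b).

Definition K0 (A : set vec) : Prop := closed A /\ convex_set_of A /\ A 0.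

Definition polar (A : set vec) : set vec :=
  [set x | forall a, A a -> dotv a x <= 1].

Definition dist (x : vec) (A : set vec) : R := inf [set enorm (x - a) | a in A].

Definition dAW (A K : set vec) : R :=
  sup [set Num.min (j%:R^-1)
             (sup [set `|dist x A - dist x K| | x in [set x | enorm x < j%:R]])
      | j in [set j : nat | (0 < j)%N]].

End Defs.

(* Main.v *)
(** For [A] in [K_0^n] let [f] be half the squared gauge of [A]. The Fenchel
    conjugate of [f] is half the squared gauge of the polar, so Moreau's
    theorem gives [prox f + prox f^* = id]: on the resolvents [P_A = prox f],
    polarity is the affine involution [P -> id - P], with fixed point [id / 2],
    the resolvent of the unit ball. The segment [(1 - t) P_A + t/2 id] (a
    proximal average) is therefore an equivariant contraction.

    No gauge is needed: [P_A x] is the [R^n]-component of the projection of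
    [(x, 0)] onto the closed convex cone generated by [A x {1}], and [A] is
    recovered from [g x = <x, P_A x>] as the set of all [y] such that
    [2 <x, y> <= |y|^2 + 1 + g x] for all [x]. For continuity, closeness of
    two sets on a large ball gives closeness of the functions [g] relative to
    [|x|^2], and conversely a point [y] of one set far from the other is
    separated from it by a polar vector [w], which makes the two functions
    [g] differ at [w + y]. *)

Require Import Defs.
From HB Require Import structures.
From mathcomp Require Import all_boot all_order all_algebra.
From mathcomp Require Import all_classical all_reals all_analysis.
From mathcomp Require Import ring lra.
Import Order.TTheory GRing.Theory Num.Theory.
Import numFieldNormedType.Exports.
Local Open Scope classical_set_scope.
Local Open Scope ring_scope.

(** * Euclidean inner product and norm *)

Section InnerProduct.
Context {R : realType} {n : nat}.
Implicit Types (x y z : 'rV[R]_n) (c : R).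

Lemma dotvC x y : dotv x y = dotv y x.
Proof. by apply: eq_bigr => i _; rewrite mulrC. Qed.

Lemma dotvDl x y z : dotv (x + y) z = dotv x z + dotv y z.
Proof. by rewrite -big_split; apply: eq_bigr => i _; rewrite mxE mulrDl. Qed.

Lemma dotvZl c x z : dotv (c *: x) z = c * dotv x z.
Proof. by rewrite mulr_sumr; apply: eq_bigr => i _; rewrite mxE mulrA. Qed.

Lemma dotvNl x z : dotv (- x) z = - dotv x z.
Proof. by rewrite -scaleN1r dotvZl mulN1r. Qed.

Lemma dotvDr x y z : dotv z (x + y) = dotv z x + dotv z y.
Proof. by rewrite !(dotvC z) dotvDl. Qed.

Lemma dotvZr c x z : dotv z (c *: x) = c * dotv z x.
Proof. by rewrite !(dotvC z) dotvZl. Qed.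

Lemma dotvNr x z : dotv z (- x) = - dotv z x.
Proof. by rewrite !(dotvC z) dotvNl. Qed.

Lemma dotv0l x : dotv 0 x = 0.
Proof. by rewrite -(scale0r x) dotvZl mul0r. Qed.

Lemma dotv0r x : dotv x 0 = 0.
Proof. by rewrite dotvC dotv0l. Qed.

Definition dotvE :=
  (dotvDl, dotvDr, dotvNl, dotvNr, dotvZl, dotvZr, dotv0l, dotv0r).

Lemma dotvBB x y : dotv (x - y) (x - y) = dotv x x - 2 * dotv x y + dotv y y.
Proof. by rewrite !dotvE (dotvC y x); ring. Qed.

Lemma dotv_ge0 x : 0 <= dotv x x.
Proof. by apply: sumr_ge0 => i _; rewrite -expr2 sqr_ge0. Qed.

Lemma coord_sqr_le x (i : 'I_n) : x ord0 i ^+ 2 <= dotv x x.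
Proof.
rewrite /dotv (bigD1 i) //= -expr2 lerDl.
by apply: sumr_ge0 => j _; rewrite -expr2 sqr_ge0.
Qed.

Lemma dotv_eq0 x : dotv x x = 0 -> x = 0.
Proof.
move=> x0; apply/rowP => i; rewrite mxE; apply/eqP; rewrite -sqrf_eq0.
by rewrite eq_le sqr_ge0 -x0 coord_sqr_le.
Qed.

Lemma dotv_le x y : 2 * dotv x y <= dotv x x + dotv y y.
Proof. by have := dotv_ge0 (x - y); rewrite !dotvE (dotvC y x); lra. Qed.

Lemma enorm_ge0 x : 0 <= enorm x.
Proof. exact: sqrtr_ge0. Qed.

Lemma enorm_sqr x : enorm x ^+ 2 = dotv x x.
Proof. by rewrite sqr_sqrtr // dotv_ge0. Qed.

Lemma enorm_le c x : 0 <= c -> (enorm x <= c) = (dotv x x <= c ^+ 2).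
Proof. by move=> c0; rewrite -enorm_sqr ler_sqr // nnegrE enorm_ge0. Qed.

Lemma enorm_lt c x : 0 <= c -> (enorm x < c) = (dotv x x < c ^+ 2).
Proof. by move=> c0; rewrite -enorm_sqr ltr_sqr // nnegrE enorm_ge0. Qed.

Lemma cauchy_schwarz x y : dotv x y <= enorm x * enorm y.
Proof.
have [x0|x0] := eqVneq (enorm x) 0.
  have -> : x = 0 by apply: dotv_eq0; rewrite -enorm_sqr x0 expr0n.
  by rewrite dotv0l mulr_ge0 ?enorm_ge0.
have x_gt0 : 0 < enorm x by rewrite lt_neqAle eq_sym x0 enorm_ge0.
have [y0|y0] := eqVneq (enorm y) 0.
  have -> : y = 0 by apply: dotv_eq0; rewrite -enorm_sqr y0 expr0n.
  by rewrite dotv0r mulr_ge0 ?enorm_ge0.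
have y_gt0 : 0 < enorm y by rewrite lt_neqAle eq_sym y0 enorm_ge0.
(* Both rescaled vectors have norm |x||y|, so dividing by |x||y| gives the sharp bound. *)
have := dotv_le (enorm y *: x) (enorm x *: y).
rewrite !dotvE -!enorm_sqr => le_xy.
have xy_gt0 : 0 < enorm x * enorm y by rewrite mulr_gt0.
by rewrite -(ler_pM2l xy_gt0); nra.
Qed.

Lemma enorm_triangle x y : enorm (x + y) <= enorm x + enorm y.
Proof.
rewrite enorm_le ?addr_ge0 ?enorm_ge0 // !dotvE (dotvC y x) -!enorm_sqr.
by have := cauchy_schwarz x y; lra.
Qed.

Lemma enormN x : enorm (- x) = enorm x.
Proof. by rewrite /enorm !dotvE opprK. Qed.

Lemma enormBC x y : enorm (x - y) = enorm (y - x).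
Proof. by rewrite -enormN opprB. Qed.

Lemma enormZ c x : 0 <= c -> enorm (c *: x) = c * enorm x.
Proof.
move=> c0; apply/eqP; rewrite -(eqrXn2 (n := 2)) ?mulr_ge0 ?enorm_ge0 //.
by rewrite exprMn !enorm_sqr !dotvE mulrA expr2.
Qed.

Lemma enorm0 : enorm (0 : 'rV[R]_n) = 0.
Proof. by rewrite /enorm dotv0l sqrtr0. Qed.

End InnerProduct.

(** * Nearest points in closed sets and projection onto closed convex sets *)

Section Projection.
Context {R : realType} {n : nat}.
Implicit Types (x y : 'rV[R]_n) (S : set 'rV[R]_n).

Lemma continuous_sum_row (I : Type) (r : seq I) (f : I -> 'rV[R]_n -> R) :
  (forall i, continuous (f i)) -> continuous (fun x => \sum_(i <- r) f i x).
Proof.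
move=> fc; elim: r => [|i r IH] x.
  by under eq_fun do rewrite big_nil; exact: cst_continuous.
under eq_fun do rewrite big_cons.
by apply: (@continuousD _ _ _ (f i)); [exact: fc|exact: IH].
Qed.

Lemma dotv_cont y : continuous (fun x => dotv y x).
Proof.
apply: continuous_sum_row => i x.
by apply: (@continuousM _ _ (cst _)); [exact: cst_continuous|exact: coord_continuous].
Qed.

Lemma sqdist_cont y : continuous (fun x => dotv (y - x) (y - x)).
Proof.
apply: continuous_sum_row => i x.
have c : {for x, continuous (fun x => (y - x) ord0 i)}.
  have -> : (fun x => (y - x) ord0 i) = (fun x => y ord0 i - x ord0 i).
    by apply/funext => z; rewrite !mxE.
  by apply: (@continuousB _ _ _ (cst _)); [exact: cst_continuous|exact: coord_continuous].
exact: (@continuousM _ _ _ _ _ c c).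
Qed.

Lemma closed_sublevel (I : Type) (D : set I) (f : I -> 'rV[R]_n -> R) c :
  (forall i, continuous (f i)) -> closed [set x | forall i, D i -> f i x <= c].
Proof.
move=> fc.
have -> : [set x | forall i, D i -> f i x <= c] =
    \bigcap_(i in D) (f i @^-1` [set r | r <= c]) by [].
apply: closed_bigI => i _; apply: preimage_closed; last exact: closed_le.
by move=> x _; exact: fc.
Qed.

Lemma nearest_point S y : closed S -> S !=set0 ->
  exists2 p, S p & forall q, S q -> dotv (y - p) (y - p) <= dotv (y - q) (y - q).
Proof.
(* Since [M] is at least 1, a coordinate whose square is below [M] is itself bounded by [M]; this
   confines the search to a compact box. *)
move=> Scl [p0 Sp0]; pose M := dotv (y - p0) (y - p0) + 1.
have M1 : 1 <= M by rewrite lerDr dotv_ge0.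
pose K := [set q : 'rV[R]_n | forall i, `[y ord0 i - M, y ord0 i + M]%classic (q ord0 i)].
have Kc : compact (K `&` S).
  by apply: compact_closedI => //; apply: (@rV_compact R n
    (fun i => `[y ord0 i - M, y ord0 i + M]%classic)) => i; exact: segment_compact.
have KP q : dotv (y - q) (y - q) < M -> K q.
  move=> qM i; have := le_lt_trans (coord_sqr_le (y - q) i) qM.
  by rewrite !mxE /= in_itv /= => h; apply/andP; split; nra.
have K0 : K `&` S !=set0 by exists p0; split=> //; apply: KP; rewrite ltrDl.
have [p /set_mem[Kp Sp] pmin] :=
  EVT_min_rV K0 Kc (continuous_subspaceT (sqdist_cont y)).
exists p => // q Sq; have [qM|qM] := ltP (dotv (y - q) (y - q)) M.
  by apply: pmin; apply/mem_set; split=> //; exact: KP.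
apply: le_trans qM; apply: le_trans (pmin p0 _) _; last by rewrite lerDl.
by apply/mem_set; split=> //; apply: KP; rewrite ltrDl.
Qed.

Lemma projection S y : closed S -> convex_set_of S -> S !=set0 ->
  exists2 p, S p & forall q, S q -> dotv (y - p) (q - p) <= 0.
Proof.
move=> Scl Scv S0; have [p Sp pmin] := nearest_point S y Scl S0.
exists p => // q Sq; rewrite leNgt; apply/negP => a_gt0.
set a := dotv _ _ in a_gt0; set b := dotv (q - p) (q - p).
have b0 : 0 <= b by exact: dotv_ge0.
(* Moving from [p] towards [q] by [l] changes the squared distance by l (l b - 2 a), and this [l]
   makes l b < a. *)
pose l := a / (a + b).
have ab : 0 < a + b by lra.
have l0 : 0 < l by exact: divr_gt0.
have l1 : l <= 1 by rewrite ler_pdivrMr //; lra.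
have lE : l * (a + b) = a by rewrite mulfVK ?gt_eqF.
have := pmin _ (Scv q p Sq Sp l (ltW l0) l1).
have -> : y - (l *: q + (1 - l) *: p) = (y - p) - l *: (q - p).
  by apply/rowP => i; rewrite !mxE; ring.
rewrite (dotvBB (y - p)) dotvZl !dotvZr -/a -/b.
by nra.
Qed.

End Projection.

(** * Bipolar theorem and Moreau decomposition *)

Section Polarity.
Context {R : realType} {n : nat}.
Implicit Types (x y z u v : 'rV[R]_n) (s r : R) (A B : set 'rV[R]_n).

Lemma polar_K0 A : K0 (polar A).
Proof.
split; last split.
- exact: (closed_sublevel _ A (fun a x => dotv a x) 1 dotv_cont).
- move=> x y Ax Ay l l0 l1 a Aa; rewrite !dotvE.
  by have := Ax _ Aa; have := Ay _ Aa; nra.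
- by move=> a _; rewrite dotv0r ler01.
Qed.

Lemma bipolar A : K0 A -> polar (polar A) = A.
Proof.
move=> [Acl [Acv A0]]; apply/seteqP; split=> [y ppy|a Aa u Au]; last first.
  by rewrite dotvC; exact: Au.
have [p Ap pP] := projection A y Acl Acv (ex_intro _ 0 A0).
have [u0|u0] := eqVneq (dotv (y - p) (y - p)) 0.
  by have -> : y = p by apply/eqP; rewrite -subr_eq0 (dotv_eq0 _ u0).
have u_gt0 : 0 < dotv (y - p) (y - p) by rewrite lt_neqAle eq_sym u0 dotv_ge0.
have t0 : 0 <= dotv (y - p) p by have := pP _ A0; rewrite sub0r dotvNr oppr_le0.
have yE : dotv (y - p) y = dotv (y - p) p + dotv (y - p) (y - p).
  by rewrite -dotvDr (addrC p) subrK.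
(* [m] lies midway between the values of <y - p, .> at [p] and at [y], so it is positive even if the
   value at [p] is 0. *)
pose m := dotv (y - p) p + dotv (y - p) (y - p) / 2.
have m0 : 0 < m by rewrite ltr_wpDl // divr_gt0.
have /ppy : polar A (m^-1 *: (y - p)).
  move=> a Aa; rewrite dotvZr ler_pdivrMl // mulr1 dotvC.
  by have := pP _ Aa; rewrite dotvDr dotvNr /m; lra.
by rewrite dotvZl ler_pdivrMl // mulr1 yE /m; lra.
Qed.

(* [(z, s)] lies in the closed convex cone of [R^n x R] generated by [polar A]
   at height [1]; [s = 0] gives the recession directions. *)
Definition polar_cone A z s := forall a, A a -> dotv a z <= s.

Lemma polar_cone_scale A z s : 0 < s -> polar_cone A z s -> polar A (s^-1 *: z).
Proof. by move=> s0 Az a Aa; rewrite dotvZr ler_pdivrMl // mulr1 Az. Qed.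

(** As [s] may be 0, [v] is normalised at height [s + e] instead; [e] is so small that the added
    error e r stays below the assumed gap. *)
Lemma polar_cone_pairing A v z s r : 0 <= s -> 0 <= r ->
  polar_cone A v s -> polar_cone (polar A) z r -> dotv v z <= s * r.
Proof.
move=> s0 r0 Av Az; rewrite leNgt; apply/negP => d_gt0.
pose e := (dotv v z - s * r) / (r + 1).
have r1 : 0 < r + 1 by lra.
have eE : e * (r + 1) = dotv v z - s * r by rewrite mulfVK ?gt_eqF.
have e0 : 0 < e by rewrite divr_gt0 // subr_gt0.
have se : 0 < s + e by lra.
have /Az : polar A ((s + e)^-1 *: v).
  by apply: polar_cone_scale => // a /Av h; lra.
by rewrite dotvZl ler_pdivrMl //; nra.
Qed.

(* The Moreau decomposition of [(x, 0)] along the cone over [A] and its polar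
   cone, the reflected cone over [polar A]. *)
Definition moreau A x z s :=
  [/\ 0 <= s, dotv z (x - z) = s ^+ 2, polar_cone (polar A) z s
    & polar_cone A (x - z) s].

Lemma dotv_row_mx (u v : 'rV[R]_n) (a b : R) :
  dotv (row_mx u (a%:M : 'M[R]_1)) (row_mx v (b%:M : 'M[R]_1)) = dotv u v + a * b.
Proof.
rewrite /dotv big_split_ord /=; congr (_ + _).
  by apply: eq_bigr => i _; rewrite !row_mxEl.
by rewrite big_ord1 !row_mxEr !mxE.
Qed.

Lemma moreau_exists A x : K0 A -> exists z s, moreau A x z s.
Proof.
move=> KA.
(* An intersection of half-spaces, hence closed and convex without taking a closure. *)
pose C := [set w | forall u, polar A u -> dotv (row_mx u ((-1)%:M : 'M[R]_1)) w <= 0].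
have CE z s : C (row_mx z s%:M) <-> polar_cone (polar A) z s.
  by split=> h u /h; rewrite dotv_row_mx; lra.
have Ccl : closed C.
  exact: (closed_sublevel _ (polar A) (fun u w => dotv (row_mx u (-1)%:M) w) 0
    (fun u => dotv_cont _)).
have Ccv : convex_set_of C.
  move=> w w' Cw Cw' l l0 l1 u Au; rewrite dotvDr !dotvZr.
  by have := Cw _ Au; have := Cw' _ Au; nra.
have C0 : C 0 by move=> u _; rewrite dotv0r.
have [p Cp pP] := projection C (row_mx x 0%:M) Ccl Ccv (ex_intro _ 0 C0).
move: Cp pP; rewrite -(hsubmxK p) [rsubmx p]mx11_scalar.
set z := lsubmx p; set s := rsubmx p _ _ => /CE Cp pP.
have {}pP z' s' : polar_cone (polar A) z' s' ->
    dotv (x - z) (z' - z) - s * (s' - s) <= 0.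
  move=> /CE/pP; rewrite !opp_row_mx !add_row_mx -!raddfB /= dotv_row_mx.
  by rewrite sub0r mulNr.
have s0 : 0 <= s by rewrite -(dotv0l z); apply: Cp => a _; rewrite dotv0r ler01.
have zs : dotv z (x - z) = s ^+ 2.
  (* The multiples 0 and 2 of the projected point give the two opposite inequalities. *)
  have h1 := pP 0 0 (fun a _ => eq_ind_r (fun r => r <= 0) (lexx 0) (dotv0r a)).
  have h2 : dotv (x - z) (2 *: z - z) - s * (2 * s - s) <= 0.
    by apply: pP => a /Cp; rewrite dotvZr; lra.
  move: h1 h2; have -> : 2 *: z - z = z by rewrite scaler_nat mulr2n addrK.
  by rewrite sub0r dotvNr (dotvC z); lra.
exists z, s; split=> // a Aa.
have := pP a 1 (fun u Au => eq_ind_r (fun r => r <= 1) (Au a Aa) (dotvC u a)).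
by rewrite dotvDr dotvNr (dotvC _ z) zs (dotvC a); lra.
Qed.

Lemma moreau_polar A x z s : K0 A -> moreau A x z s -> moreau (polar A) x (x - z) s.
Proof.
move=> KA [s0 zs Az Av]; rewrite /moreau bipolar // subKr.
by split=> //; rewrite dotvC.
Qed.

Lemma moreau_dotv A x z s : moreau A x z s -> dotv x z = dotv z z + s ^+ 2.
Proof. by move=> [_ <- _ _]; rewrite dotvDr dotvNr (dotvC x); ring. Qed.

(** Pairing each decomposition with the other and adding gives |z - z'|^2 + (s - s')^2 <= 0. *)
Lemma moreau_unique A x z s z' s' :
  moreau A x z s -> moreau A x z' s' -> z = z'.
Proof.
move=> Mz Mz'; have zs := moreau_dotv _ _ _ _ Mz; have zs' := moreau_dotv _ _ _ _ Mz'.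
case: Mz => s0 _ Az Av; case: Mz' => s0' _ Az' Av'.
have h := polar_cone_pairing _ _ _ _ _ s0 s0' Av Az'.
have h' := polar_cone_pairing _ _ _ _ _ s0' s0 Av' Az.
apply/eqP; rewrite -subr_eq0; apply/eqP/dotv_eq0/eqP.
rewrite eq_le dotv_ge0 andbT dotvBB.
move: h h'; rewrite !dotvDl !dotvNl zs zs' (dotvC z' z).
by have := sqr_ge0 (s - s'); nra.
Qed.

End Polarity.

(** * Resolvents and the convex sets they encode *)

Section Resolvents.
Context {R : realType} {n : nat}.
Implicit Types (x y z u v : 'rV[R]_n) (s r t c : R) (A B : set 'rV[R]_n)
  (P : 'rV[R]_n -> 'rV[R]_n).

(* [2 <y, P x> <= g x + g y] with [g x = <x, P x>]: the tangent inequality of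
   the convex function [g / 2], whose gradient at [x] is [P x]. It is linear
   in [P]. *)
Definition tangent P := forall x y,
  2 * dotv y (P x) <= dotv x (P x) + dotv y (P y).

(** These conditions survive both P -> id - P and convex combinations, which is all that the
    homotopy uses. *)
Definition resolvent P := [/\ tangent P, tangent (fun x => x - P x)
  & forall c x, 0 < c -> dotv (c *: x) (P (c *: x)) = c ^+ 2 * dotv x (P x)].

(** For P = prox f, the conjugate of g / 2 is f + |.|^2 / 2, so the condition says f(y) <= 1/2, that
    is, gauge at most 1. *)
Definition resolvent_set P :=
  [set y | forall x, 2 * dotv x y <= dotv y y + 1 + dotv x (P x)].

Lemma tangent_ge0 P x : tangent P -> 0 <= dotv x (P x).
Proof. by move=> /(_ x 0); rewrite !dotv0l mulr0 addr0. Qed.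

Lemma resolvent_setE P : resolvent_set P =
  [set y | forall x, dotv x (x - P x) - dotv (x - y) (x - y) <= 1].
Proof.
by apply/seteqP; split=> y yP x; have := yP x; rewrite dotvBB dotvDr dotvNr; lra.
Qed.

Lemma resolvent_set_K0 P : resolvent P -> K0 (resolvent_set P).
Proof.
move=> [TP TQ _]; split; last split.
- rewrite resolvent_setE.
  have fc x : continuous (fun y => dotv x (x - P x) - dotv (x - y) (x - y)).
    move=> y; apply: (@continuousB _ _ _ (cst (dotv x (x - P x)))
      (fun y => dotv (x - y) (x - y))); first exact: cst_continuous.
    exact: sqdist_cont.
  have -> : [set y | forall x, dotv x (x - P x) - dotv (x - y) (x - y) <= 1] =
      [set y | forall x, setT x -> dotv x (x - P x) - dotv (x - y) (x - y) <= 1].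
    by apply/seteqP; split=> y yP x => [_|]; exact: yP.
  exact: (closed_sublevel _ setT
    (fun x y => dotv x (x - P x) - dotv (x - y) (x - y)) 1 fc).
- rewrite resolvent_setE => a b aP bP l l0 l1 x /=.
  set m := l *: a + (1 - l) *: b.
  (* The tangent plane at [x] is tested at the translates of [x] that sit over
     [a] and [b] as [x] sits over [m]. *)
  have := aP (a + (x - m)); have := bP (b + (x - m)).
  have /= := TQ x (a + (x - m)); have /= := TQ x (b + (x - m)).
  have -> : a + (x - m) - a = x - m by rewrite addrC addKr.
  have -> : b + (x - m) - b = x - m by rewrite addrC addKr.
  set q := x - P x.
  have -> : dotv x q = l * dotv (a + (x - m)) q + (1 - l) * dotv (b + (x - m)) q.
    by rewrite -!dotvZl -dotvDl; congr dotv; apply/rowP => i; rewrite !mxE; ring.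
  by nra.
- move=> x; rewrite !dotv0r mulr0 add0r addr_ge0 //; exact: tangent_ge0.
Qed.

Lemma resolvent_set_polar P : resolvent P ->
  resolvent_set (fun x => x - P x) = polar (resolvent_set P).
Proof.
move=> [TP TQ hom]; apply/seteqP; split=> [v vQ y yP|v vP x].
  (* At [y + v] the two conditions add up with g cancelling, leaving <y, v> <= 1. *)
  have := yP (y + v); have := vQ (y + v).
  by rewrite !(dotvDr, dotvNr, dotvDl) (dotvC v y); lra.
set p := P x; set q := x - p.
have pq : dotv x p = dotv p p + dotv p q by rewrite -dotvDr addrC subrK dotvC.
have xq : dotv x q = dotv p q + dotv q q by rewrite -dotvDl addrC subrK.
have pq0 : 0 <= dotv p q.
  have := TP x p; have := tangent_ge0 _ p TQ; rewrite dotvDr dotvNr -/p pq; lra.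
(* By AM-GM s^2 >= <p, q>, which puts p / s in the set, while 2 s is exactly the slack available at
   the end. *)
pose s := (1 + dotv p q) / 2.
have s0 : 0 < s by rewrite divr_gt0 //; lra.
have s2 : dotv p q <= s ^+ 2 by have := sqr_ge0 (1 - dotv p q); rewrite /s; nra.
have /vP : resolvent_set P (s^-1 *: p).
  move=> y; have := TP x (s *: y); rewrite -/p hom // pq !(dotvZl, dotvZr) => h.
  have s1 : s * s^-1 = 1 by rewrite divff ?gt_eqF.
  rewrite -(ler_pM2l (exprn_gt0 2 s0)).
  have -> : s ^+ 2 * (2 * (s^-1 * dotv y p)) = 2 * (s * dotv y p) * (s * s^-1) by ring.
  have -> : s ^+ 2 * (s^-1 * (s^-1 * dotv p p) + 1 + dotv y (P y)) =
    (s * s^-1) ^+ 2 * dotv p p + s ^+ 2 + s ^+ 2 * dotv y (P y) by ring.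
  by rewrite s1; lra.
rewrite dotvZl ler_pdivrMl // mulr1 => pv.
have := dotv_le q v.
have -> : dotv x v = dotv p v + dotv q v by rewrite -dotvDl addrC subrK.
by rewrite xq; rewrite /s in pv; lra.
Qed.

Definition mix t P x := (1 - t) *: P x + (t / 2) *: x.

Lemma mix_compl t P : mix t (fun x => x - P x) = (fun x => x - mix t P x).
Proof.
by apply/funext => x; apply/rowP => i; rewrite !mxE; field.
Qed.

Lemma dotv_mix t P x y :
  dotv y (mix t P x) = (1 - t) * dotv y (P x) + t / 2 * dotv y x.
Proof. by rewrite !dotvE. Qed.

Lemma tangent_mix t P : 0 <= t -> t <= 1 -> tangent P -> tangent (mix t P).
Proof.
move=> t0 t1 TP x y; rewrite !dotv_mix (dotvC y x).
by have := TP x y; have := dotv_le x y; nra.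
Qed.

Lemma resolvent_mix t P : 0 <= t -> t <= 1 -> resolvent P -> resolvent (mix t P).
Proof.
move=> t0 t1 [TP TQ hom]; split; first exact: tangent_mix.
  by rewrite -mix_compl; exact: tangent_mix.
by move=> c x c0; rewrite !dotv_mix hom // !dotvE; ring.
Qed.

Definition moreau_map A x := xget 0 [set z | exists s, moreau A x z s].

Lemma moreau_mapP A x : K0 A -> exists s, moreau A x (moreau_map A x) s.
Proof.
move=> /(moreau_exists A x)[z zP].
by rewrite /moreau_map; case: xgetP => // /(_ z).
Qed.

Lemma moreau_map_polar A : K0 A ->
  moreau_map (polar A) = (fun x => x - moreau_map A x).
Proof.
move=> KA; apply/funext => x.
have [s /(moreau_polar _ _ _ _ KA) Ms] := moreau_mapP A x KA.
have [s' Ms'] := moreau_mapP (polar A) x (polar_K0 A).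
exact: moreau_unique Ms' Ms.
Qed.

(** Write y = P y + (y - P y): the first part pairs with P x by AM-GM, the second by
    [polar_cone_pairing], and 2 r s <= r^2 + s^2. *)
Lemma moreau_map_tangent A : K0 A -> tangent (moreau_map A).
Proof.
move=> KA x y; have [s Mx] := moreau_mapP A x KA; have [r My] := moreau_mapP A y KA.
rewrite (moreau_dotv _ _ _ _ Mx) (moreau_dotv _ _ _ _ My).
case: Mx => s0 _ Ax _; case: My => r0 _ _ Ay.
have := polar_cone_pairing _ _ _ _ _ r0 s0 Ay Ax.
have := dotv_le (moreau_map A y) (moreau_map A x).
by rewrite dotvDl dotvNl; have := sqr_ge0 (s - r); nra.
Qed.

Lemma moreau_map_resolvent A : K0 A -> resolvent (moreau_map A).
Proof.
move=> KA; split; first exact: moreau_map_tangent.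
  rewrite -moreau_map_polar //; apply: moreau_map_tangent; exact: polar_K0.
move=> c x c0; suff -> : moreau_map A (c *: x) = c *: moreau_map A x.
  by rewrite !dotvE; ring.
have [s [s0 zs Az Av]] := moreau_mapP A x KA.
have [s' Ms'] := moreau_mapP A (c *: x) KA.
apply: (moreau_unique _ _ _ _ _ (c * s) Ms'); split.
- by rewrite mulr_ge0 // ltW.
- by rewrite -scalerBr !dotvE exprMn -zs !dotvE; ring.
- by move=> u /Az; rewrite dotvZr ler_pM2l.
- by move=> a /Av; rewrite -scalerBr dotvZr ler_pM2l.
Qed.

Lemma subset_resolvent_set A : K0 A -> A `<=` resolvent_set (moreau_map A).
Proof.
move=> KA a Aa x; have [s Mx] := moreau_mapP A x KA.
rewrite (moreau_dotv _ _ _ _ Mx); case: Mx => s0 _ _ /(_ a Aa).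
rewrite dotvDr dotvNr (dotvC a x).
by have := dotv_le a (moreau_map A x); have := sqr_ge0 (1 - s); nra.
Qed.

Lemma resolvent_set_moreau_map A : K0 A -> resolvent_set (moreau_map A) = A.
Proof.
move=> KA; apply/seteqP; split; last exact: subset_resolvent_set.
move=> y yP; rewrite -(bipolar _ KA) => u Au.
(* The polar set obeys the same bound with id - P, so testing at [u + y] yields <u, y> <= 1. *)
have := subset_resolvent_set _ (polar_K0 A) _ Au (u + y).
rewrite moreau_map_polar //; have := yP (u + y).
by rewrite dotvDr dotvNr !dotvDl !dotvDr (dotvC y u); lra.
Qed.

End Resolvents.

(** * Attouch-Wets metric and one-sided excess on balls *)

Section AttouchWets.
Context {R : realType} {n : nat}.
Implicit Types (x y z : 'rV[R]_n) (rho delta eta eps : R) (A B D : set 'rV[R]_n).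

Lemma dist_has_lbound x A : has_lbound [set enorm (x - a) | a in A].
Proof. by exists 0 => _ [a _ <-]; exact: enorm_ge0. Qed.

Lemma dist_le x A a : A a -> dist x A <= enorm (x - a).
Proof. by move=> Aa; apply: ge_inf; [exact: dist_has_lbound|exists a]. Qed.

Lemma dist_ge0 x A a : A a -> 0 <= dist x A.
Proof.
move=> Aa; apply: lb_le_inf; first by exists (enorm (x - a)), a.
by move=> _ [b _ <-]; exact: enorm_ge0.
Qed.

Lemma dist_lt x A a eps : A a -> dist x A < eps -> exists2 b, A b & enorm (x - b) < eps.
Proof.
move=> Aa /inf_lt[]; first by exists (enorm (x - a)), a.
by move=> _ [b Ab <-] be; exists b.
Qed.

Lemma dist_diff_le x A B : A 0 -> B 0 -> `|dist x A - dist x B| <= enorm x.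
Proof.
move=> A0 B0; have := dist_le x _ _ A0; have := dist_le x _ _ B0.
have := dist_ge0 x _ _ A0; have := dist_ge0 x _ _ B0.
by rewrite subr0 ler_norml; lra.
Qed.

Let gap A B j := [set `|dist x A - dist x B| | x in [set x | enorm x < j%:R]].

Lemma gap_has_ubound A B j : A 0 -> B 0 -> has_ubound (gap A B j).
Proof.
move=> A0 B0; exists j%:R => _ [x /ltW xj <-].
exact: le_trans (dist_diff_le _ _ _ A0 B0) xj.
Qed.

Lemma dAW_has_ubound A B : has_ubound
  [set Num.min (j%:R^-1) (sup (gap A B j)) | j in [set j : nat | (0 < j)%N]].
Proof.
exists 1 => _ [j /= j0 <-]; rewrite ge_min invf_le1 ?ltr0n // ler1n.
by rewrite j0.
Qed.

Lemma dAWC A B : dAW A B = dAW B A.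
Proof.
have gapC j : gap A B j = gap B A j.
  by apply/seteqP; split=> _ [x xj <-]; exists x => //; rewrite distrC.
congr sup; apply/seteqP; split=> _ [j j0 <-]; exists j => //.
  by rewrite -/(gap A B j) gapC.
by rewrite -/(gap A B j) gapC.
Qed.

Definition excess A B rho delta :=
  forall a, A a -> enorm a < rho -> exists2 b, B b & enorm (a - b) < delta.

(** Since delta <= 1/j, the minimum in the j-th term can only be below delta through the
    supremum. *)
Lemma dAW_excess A B (j : nat) delta : A 0 -> B 0 -> (0 < j)%N ->
  delta <= j%:R^-1 -> dAW A B < delta -> excess A B j%:R delta.
Proof.
move=> A0 B0 j0 dj AB a Aa aj.
have : Num.min (j%:R^-1) (sup (gap A B j)) < delta.
  by apply: le_lt_trans AB; apply: ub_le_sup; [exact: dAW_has_ubound|exists j].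
rewrite gt_min ltNge dj /= => supd; apply: (dist_lt _ _ _ _ B0).
apply: le_lt_trans supd.
have : `|dist a A - dist a B| <= sup (gap A B j).
  by apply: ub_le_sup; [exact: gap_has_ubound|exists a].
rewrite distrC; apply: le_trans; apply: le_trans (ler_norm _).
have := dist_le a _ _ Aa; rewrite subrr enorm0; have := dist_ge0 a _ _ Aa; lra.
Qed.

Lemma excess_dist A B rho delta x : A 0 -> B 0 -> 2 * enorm x < rho ->
  excess A B rho delta -> dist x B <= dist x A + delta.
Proof.
move=> A0 B0 xrho AB; rewrite leNgt; apply/negP => lt.
(* The second bound keeps the near point [a] in the ball of radius [rho]; it exceeds [dist x A]
   because 0 is in [A]. *)
pose c := Num.min (dist x B - delta) (rho - enorm x).
have : dist x A < c.
  rewrite lt_min; apply/andP; split; first lra.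
  by have := dist_le x _ _ A0; rewrite subr0; lra.
move=> /(dist_lt _ _ _ _ A0)[a Aa]; rewrite lt_min => /andP[xa1 xa2].
have /AB[//|b Bb ab] : enorm a < rho.
  have := enorm_triangle (a - x) x; rewrite subrK enormBC; lra.
have := dist_le x _ _ Bb; have := enorm_triangle (x - a) (a - b).
by rewrite addrA subrK; lra.
Qed.

(** Terms of index above j are at most 1/(j+1); the others are controlled by [excess_dist], which
    doubles the radius. *)
Lemma excess_dAW A B (j : nat) delta : A 0 -> B 0 -> 0 <= delta ->
  excess A B (2 * j%:R) delta -> excess B A (2 * j%:R) delta ->
  dAW A B <= Num.max delta (j.+1%:R^-1).
Proof.
move=> A0 B0 d0 AB BA; apply: ge_sup.
  by exists (Num.min 1%:R^-1 (sup (gap A B 1))), 1%N.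
move=> _ [i /= i0 <-]; rewrite le_max !ge_min.
have [ij|ji] := leqP i j; last first.
  by rewrite [X in _ || (X || _)]lef_pV2 ?posrE ?ltr0n // ler_nat ji orbT.
apply/orP; left; apply/orP; right; apply: ge_sup.
  by exists `|dist 0 A - dist 0 B|, 0 => //=; rewrite enorm0 ltr0n.
move=> _ [x /= xi <-].
have x2 : 2 * enorm x < 2 * j%:R by rewrite ltr_pM2l // (lt_le_trans xi) // ler_nat.
have := excess_dist _ _ _ _ _ A0 B0 x2 AB; have := excess_dist _ _ _ _ _ B0 A0 x2 BA.
by rewrite ler_norml; lra.
Qed.

Lemma excess_le A B rho delta rho' delta' : rho' <= rho -> delta <= delta' ->
  excess A B rho delta -> excess A B rho' delta'.
Proof.
move=> rr dd AB a Aa ar; have [b Bb ab] := AB a Aa (lt_le_trans ar rr).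
by exists b => //; exact: lt_le_trans dd.
Qed.

(** * Quantitative passage between sets and resolvents *)

Lemma moreau_norm A x z s : moreau A x z s ->
  dotv z z + 2 * s ^+ 2 + dotv (x - z) (x - z) = dotv x x.
Proof. by move=> Mx; have := moreau_dotv _ _ _ _ Mx; rewrite dotvBB; lra. Qed.

(** A perturbed tangent inequality: replacing z / (s + eta) by a nearby point of [B] gives <z, x -
    w> <= (s + eta) (r + delta) <= s r + 2 eta, since delta + eta delta = eta. *)
Lemma moreau_map_excess_unit A B eta delta x : K0 A -> K0 B ->
  0 < eta -> 0 < delta -> delta * (1 + eta) = eta ->
  excess A B (eta^-1 + 1) delta -> enorm x = 1 ->
  dotv x (moreau_map A x) - dotv x (moreau_map B x) <= 4 * eta.
Proof.
move=> KA KB eta0 d0 dE AB x1.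
have [s Mx] := moreau_mapP A x KA; have [r My] := moreau_mapP B x KB.
have zE := moreau_dotv _ _ _ _ Mx; have wE := moreau_dotv _ _ _ _ My.
have zN := moreau_norm _ _ _ _ Mx; have wN := moreau_norm _ _ _ _ My.
move: Mx My zE wE zN wN; set z := moreau_map A x; set w := moreau_map B x.
rewrite -(enorm_sqr x) x1 expr1n => -[s0 _ Az _] [r0 _ _ Bw] zE wE zN wN.
have := dotv_ge0 z; have := dotv_ge0 (x - z); have := dotv_ge0 w.
have := dotv_ge0 (x - w) => v0 w0 vx0 z0.
have s2 := sqr_ge0 s; have r2 := sqr_ge0 r.
have z1 : enorm z <= 1 by rewrite enorm_le // expr1n; lra.
have v1 : enorm (x - w) <= 1 by rewrite enorm_le // expr1n; lra.
have s1 : s <= 1 by rewrite -(@expr_le1 _ 2) //; lra.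
have r1 : r <= 1 by rewrite -(@expr_le1 _ 2) //; lra.
(* [s] may vanish, in which case [z] is only a recession direction of [A]. *)
have seta : 0 < s + eta by lra.
have Aa : A ((s + eta)^-1 *: z).
  rewrite -(bipolar _ KA); apply: polar_cone_scale => // u /Az; lra.
have aR : enorm ((s + eta)^-1 *: z) < eta^-1 + 1.
  rewrite enormZ ?invr_ge0 ?ltW // ltr_pwDr //.
  rewrite -[leRHS]mulr1 ler_pM ?enorm_ge0 ?invr_ge0 ?(ltW seta) //.
  by rewrite lef_pV2 ?posrE //; lra.
have [b Bb ab] := AB _ Aa aR.
have : dotv ((s + eta)^-1 *: z) (x - w) <= r + delta.
  rewrite -(subrK b ((s + eta)^-1 *: z)) dotvDl addrC lerD //; first exact: Bw.
  apply: le_trans (cauchy_schwarz _ _) _.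
  by rewrite -[leRHS]mulr1 ler_pM ?enorm_ge0 // ltW.
rewrite dotvZl ler_pdivrMl // => zv.
have := dotv_le w z.
have xz : dotv x z = dotv w z + dotv z (x - w).
  by rewrite (dotvC w) -dotvDr (addrC w) subrK dotvC.
have sd : s * delta <= delta by rewrite ler_piMl // ltW.
have er : eta * r <= eta by rewrite ler_piMr // ltW.
by have := sqr_ge0 (s - r); lra.
Qed.

Lemma moreau_map_excess eps : 0 < eps -> exists rho delta, [/\ 0 < rho, 0 < delta &
  forall A B, K0 A -> K0 B -> excess A B rho delta -> forall x,
  dotv x (moreau_map A x) - dotv x (moreau_map B x) <= eps * dotv x x].
Proof.
move=> e0; pose eta := eps / 4; have eta0 : 0 < eta by rewrite divr_gt0.
pose delta := eta / (1 + eta).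
have dE : delta * (1 + eta) = eta by rewrite mulfVK // gt_eqF //; lra.
have d0 : 0 < delta by rewrite divr_gt0 //; lra.
exists (eta^-1 + 1), delta; split=> //; first by rewrite addr_gt0 ?invr_gt0.
move=> A B KA KB AB x.
have [-> | x0] := eqVneq x 0; first by rewrite !dotv0l; lra.
have nx : 0 < enorm x.
  rewrite lt_neqAle enorm_ge0 andbT eq_sym; apply: contra x0 => /eqP h.
  by apply/eqP/dotv_eq0; rewrite -enorm_sqr h expr0n.
have [_ _ /(_ (enorm x) ((enorm x)^-1 *: x) nx)] := moreau_map_resolvent _ KA.
have [_ _ /(_ (enorm x) ((enorm x)^-1 *: x) nx)] := moreau_map_resolvent _ KB.
rewrite scalerA divff ?gt_eqF // scale1r => -> ->; rewrite -enorm_sqr -mulrBr mulrC.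
apply: ler_wpM2r; first exact: sqr_ge0.
have -> : eps = 4 * eta by rewrite mulrC divfK.
apply: (moreau_map_excess_unit _ _ _ delta) => //.
by rewrite enormZ ?invr_ge0 ?enorm_ge0 // mulVf ?gt_eqF.
Qed.

Lemma resolvent_set_excess rho eta : 0 < rho -> 0 < eta -> exists2 eps, 0 < eps &
  forall P Q : 'rV[R]_n -> 'rV[R]_n, resolvent P -> resolvent Q ->
  (forall x, dotv x (P x) - dotv x (Q x) <= eps * dotv x x) ->
  excess (resolvent_set P) (resolvent_set Q) rho eta.
Proof.
(* Below, [d], [m] and |y|^2 are at most rho^2, so [M] bounds 2 (d + m^2 |y|^2). This gives d^2 <= 2
   eps M, against d^2 >= eta^4 = 4 eps M. *)
move=> rho0 eta0; pose M := 2 * rho ^+ 2 + 2 * rho ^+ 6.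
have M0 : 0 < M by rewrite addr_gt0 // mulr_gt0 ?exprn_gt0.
pose eps := eta ^+ 4 / (4 * M).
have eE : 4 * M * eps = eta ^+ 4 by rewrite mulrC divfK // gt_eqF // mulr_gt0.
have e0 : 0 < eps by rewrite divr_gt0 ?exprn_gt0 // mulr_gt0.
exists eps => // P Q RP RQ PQ y Dy yrho.
have [Dcl [Dcv D0]] := resolvent_set_K0 _ RQ.
have [p Dp pP] := projection _ y Dcl Dcv (ex_intro _ 0 D0).
exists p => //; rewrite enorm_lt ?(ltW eta0) // ltNge; apply/negP => le_eta.
set u := y - p in le_eta pP; set d := dotv u u in le_eta.
have d0 : 0 < d by rewrite (lt_le_trans _ le_eta) ?exprn_gt0.
have t0 : 0 <= dotv u p by have := pP _ D0; rewrite sub0r dotvNr oppr_le0.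
have uy : dotv u y = dotv u p + d by rewrite /d -dotvDr (addrC p) subrK.
have yy : dotv y y = dotv p p + 2 * dotv u p + d.
  by rewrite /d dotvBB /u dotvDl dotvNl (dotvC y p); ring.
have y2 : dotv y y < rho ^+ 2 by rewrite -enorm_lt // ltW.
pose m := dotv u p + d / 2.
have m0 : 0 < m by rewrite ltr_wpDl // divr_gt0.
have Ew : resolvent_set (fun x => x - Q x) (m^-1 *: u).
  rewrite resolvent_set_polar // => a Da; rewrite dotvZr ler_pdivrMl // mulr1.
  by have := pP _ Da; rewrite dotvDr dotvNr dotvC /m; lra.
(* [m^-1 *: u] lies in the polar of the target and separates it from [y]; the
   resulting functions differ at the sum of these two points. *)
pose w := m^-1 *: u.
have := Ew (w + y); have := Dy (w + y); have := PQ (w + y).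
rewrite (dotvDr (w + y)) dotvNr -/w.
move: (dotv (w + y) (P (w + y))) (dotv (w + y) (Q (w + y))) => gP gQ.
have mw : m *: w = u by rewrite scalerA divff ?gt_eqF // scale1r.
have mwy : m * dotv w y = m + d / 2 by rewrite -dotvZl mw uy /m; field.
have mww : m ^+ 2 * dotv w w = d by rewrite /d -mw !dotvE; ring.
rewrite !dotvDl !dotvDr (dotvC y w) => PQw Dw Ew'.
have {PQw Dw Ew'} wy : dotv w y - 1 <= eps * (dotv w w + dotv y y).
  have := ler_wpM2l (ltW e0) (dotv_le w y); lra.
have md : m * d <= 2 * eps * (d + m ^+ 2 * dotv y y).
  have := ler_wpM2l (ltW (exprn_gt0 2 m0)) wy; rewrite -mww; nra.
have m_le : m <= rho ^+ 2 by have := dotv_ge0 p; rewrite /m; lra.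
have d_le : d <= rho ^+ 2 by have := dotv_ge0 p; lra.
have my : m ^+ 2 * dotv y y <= rho ^+ 6.
  have -> : rho ^+ 6 = (rho ^+ 2) ^+ 2 * rho ^+ 2 by ring.
  apply: ler_pM => //; [exact/ltW/exprn_gt0|exact: dotv_ge0| |exact: ltW].
  by rewrite lerXn2r // nnegrE ltW // exprn_gt0.
have : 2 * eps * (d + m ^+ 2 * dotv y y) <= 2 * eps * (rho ^+ 2 + rho ^+ 6).
  by apply: ler_wpM2l; [rewrite mulr_ge0 // ltW|exact: lerD].
have : d * d <= 2 * (m * d) by rewrite mulrA ler_pM2r // /m; lra.
have : eta ^+ 4 <= d * d.
  have -> : eta ^+ 4 = eta ^+ 2 * eta ^+ 2 by ring.
  by rewrite ler_pM ?sqr_ge0.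
have : 0 < eps * M by exact: mulr_gt0.
by rewrite -eE /M; lra.
Qed.

(** * The homotopy and its uniform continuity *)

Definition polar_homotopy A t := resolvent_set (mix t (moreau_map A)).

Lemma polar_homotopy_resolvent A t : K0 A -> 0 <= t -> t <= 1 ->
  resolvent (mix t (moreau_map A)).
Proof. by move=> KA t0 t1; apply: resolvent_mix => //; exact: moreau_map_resolvent. Qed.

Lemma polar_homotopy_K0 A t : K0 A -> 0 <= t -> t <= 1 -> K0 (polar_homotopy A t).
Proof. by move=> *; apply/resolvent_set_K0/polar_homotopy_resolvent. Qed.

Lemma polar_homotopy0 A : K0 A -> polar_homotopy A 0 = A.
Proof.
move=> KA; rewrite -[RHS]resolvent_set_moreau_map //; congr resolvent_set.
by apply/funext => x; rewrite /mix subr0 scale1r mul0r scale0r addr0.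
Qed.

Lemma polar_homotopy1 A : polar_homotopy A 1 = @unit_ball R n.
Proof.
apply/seteqP; split=> [y Dy|y].
  (* Here g x = |x|^2 / 2, and [2 *: y] maximises 2 <x, y> - g x. *)
  rewrite /unit_ball /= enorm_le // expr1n; have := Dy (2 *: y).
  by rewrite dotv_mix !dotvE; lra.
rewrite /unit_ball /= enorm_le // expr1n => y1 x.
by have := dotv_le x (2 *: y); rewrite dotv_mix !dotvE; lra.
Qed.

Lemma polar_homotopy_polar A t : K0 A -> 0 <= t -> t <= 1 ->
  polar_homotopy (polar A) t = polar (polar_homotopy A t).
Proof.
move=> KA t0 t1; rewrite /polar_homotopy moreau_map_polar // mix_compl.
exact/resolvent_set_polar/polar_homotopy_resolvent.
Qed.

(** The two mixed functions differ by (1 - t) (gA - gB) + (s - t) (gB - |x|^2 / 2), where 0 <= gB <=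
    |x|^2; each summand gets half of the tolerance. *)
Lemma polar_homotopy_excess rho eta : 0 < rho -> 0 < eta ->
  exists r delta, [/\ 0 < r, 0 < delta & forall A B t s, K0 A -> K0 B ->
    0 <= t -> t <= 1 -> 0 <= s -> s <= 1 -> `|t - s| < delta -> excess A B r delta ->
    excess (polar_homotopy A t) (polar_homotopy B s) rho eta].
Proof.
move=> rho0 eta0; have [eps e0 epsP] := resolvent_set_excess _ _ rho0 eta0.
have e2 : 0 < eps / 2 by rewrite divr_gt0.
have [r [delta [r0 d0 dP]]] := moreau_map_excess _ e2.
exists r, (Num.min delta (eps / 2)); split=> //; first by rewrite lt_min d0.
move=> A B t s KA KB t0 t1 s0 s1; rewrite lt_min => /andP[_ ts].
move=> /(excess_le _ _ _ _ r delta (lexx r)) AB.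
have {}AB : excess A B r delta by apply: AB; rewrite ge_min lexx.
apply: epsP; try exact: polar_homotopy_resolvent.
move=> x; rewrite !dotv_mix.
have := dP _ _ KA KB AB x.
have [TP TQ _] := moreau_map_resolvent _ KB.
have := tangent_ge0 _ x TP; have := tangent_ge0 _ x TQ; rewrite dotvDr dotvNr.
move: (dotv x (moreau_map A x)) (dotv x (moreau_map B x)) (dotv x x) (dotv_ge0 x).
move=> gA gB q q0 gBq gB0 gAB.
have gAB' : (1 - t) * (gA - gB) <= eps / 2 * q.
  apply: (@le_trans _ _ ((1 - t) * (eps / 2 * q))).
    by rewrite ler_wpM2l // subr_ge0.
  by apply: ler_piMl; [exact: mulr_ge0 (ltW e2) q0|lra].
have : (s - t) * (gB - q / 2) <= eps / 2 * q.
  apply: le_trans (ler_norm _) _; rewrite normrM distrC ler_pM //; first exact: ltW.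
  by rewrite ler_norml; lra.
lra.
Qed.

Lemma polar_homotopy_continuous eps : 0 < eps -> exists2 delta, 0 < delta &
  forall A B t s, K0 A -> K0 B -> 0 <= t -> t <= 1 -> 0 <= s -> s <= 1 ->
    dAW A B < delta -> `|t - s| < delta ->
    dAW (polar_homotopy A t) (polar_homotopy B s) < eps.
Proof.
move=> e0; pose j := Num.truncn eps^-1.
have je : j.+1%:R^-1 < eps.
  by rewrite invf_plt ?posrE ?ltr0n // truncnS_gt.
have e2 : 0 < eps / 2 by rewrite divr_gt0.
(* For eps > 1 the index [j] is 0; the [+ 1] keeps the radius positive. *)
have j0 : 0 < 2 * j%:R + 1 :> R by rewrite ltr_wpDl // mulr_ge0.
have [r [delta [r0 d0 dP]]] := polar_homotopy_excess _ _ j0 e2.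
pose k := (Num.truncn r).+1.
have rk : r <= k%:R by rewrite ltW // truncnS_gt.
have k0 : 0 < k%:R :> R by rewrite ltr0n.
(* A distance below 1/k controls the excess on the ball of radius k, which contains that of radius
   [r]. *)
pose gamma := Num.min delta k%:R^-1.
have gamma_excess A B : K0 A -> K0 B -> dAW A B < gamma -> excess A B r delta.
  move=> [_ [_ A0]] [_ [_ B0]] AB.
  apply: (excess_le _ _ k%:R gamma); rewrite ?ge_min ?lexx //.
  by apply: dAW_excess AB; rewrite // ge_min lexx orbT.
exists gamma; first by rewrite lt_min d0 invr_gt0.
move=> A B t s KA KB t0 t1 s0 s1 AB ts.
have tsd : `|t - s| < delta by apply: (lt_le_trans ts); rewrite ge_min lexx.
have [_ [_ D0]] := polar_homotopy_K0 _ _ KA t0 t1.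
have [_ [_ E0]] := polar_homotopy_K0 _ _ KB s0 s1.
have j2 : 2 * j%:R <= 2 * j%:R + 1 :> R by rewrite lerDl.
apply: (@le_lt_trans _ _ (Num.max (eps / 2) j.+1%:R^-1)); last first.
  by rewrite gt_max je andbT; lra.
apply: excess_dAW => //; first exact: ltW.
  by apply: (excess_le _ _ _ _ _ _ j2 (lexx _)); apply: dP => //; exact: gamma_excess.
apply: (excess_le _ _ _ _ _ _ j2 (lexx _)); apply: dP => //; rewrite 1?distrC //.
by apply: gamma_excess => //; rewrite dAWC.
Qed.

End AttouchWets.

Theorem theorem4p3 (R : realType) (n : nat) (hn : (2 <= n)%N) :
  exists phi : set 'rV[R]_n -> R -> set 'rV[R]_n,
    (* phi maps K_0^n x [0,1] into K_0^n *)
    (forall A t, K0 A -> 0 <= t -> t <= 1 -> K0 (phi A t)) /\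
    (* continuity on K_0^n x [0,1] (Attouch-Wets metric x usual metric) *)
    (forall A t, K0 A -> 0 <= t -> t <= 1 ->
       forall eps : R, 0 < eps -> exists2 delta : R, 0 < delta &
         forall B s, K0 B -> 0 <= s -> s <= 1 ->
           dAW A B < delta -> `|t - s| < delta ->
           dAW (phi A t) (phi B s) < eps) /\
    (forall A, K0 A -> phi A 0 = A) /\
    (forall A, K0 A -> phi A 1 = @unit_ball R n) /\
    (forall A t, K0 A -> 0 <= t -> t <= 1 -> phi (polar A) t = polar (phi A t)).
Proof.
exists polar_homotopy; split; first exact: polar_homotopy_K0.
split=> [A t KA t0 t1 eps /(@polar_homotopy_continuous R n)[delta d0 dP]|].
  by exists delta => // B s KB s0 s1; exact: dP.
split; first exact: polar_homotopy0.
split; first by move=> A _; exact: polar_homotopy1.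
exact: polar_homotopy_polar.
Qed.
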